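(* Let $\mathcal{C}$ be a tensor-representable monoidal category with right dualising functor $R\colon\mathcal{C}^{\mathrm{op}}\to\mathcal{C}$ and left dualising functor $L\colon\mathcal{C}^{\mathrm{op}}\to\mathcal{C}$. Then $R\colon\mathcal{C}^{\mathrm{op}}\to\mathcal{C}$ is right adjoint to $L^{\mathrm{op}}\colon\mathcal{C}\to\mathcal{C}^{\mathrm{op}}$. The functor $R$ is an equivalence if and only if the canonical morphisms $$x \xrightarrow{u^{(Rx)}_x} x\otimes Rx\otimes LRx \xrightarrow{\varepsilon^{(x)}_1\otimes LRx} LRx, \qquad x\xrightarrow{\eta^{(Lx)}_x} RLx\otimes Lx\otimes x\xrightarrow{RLx\otimes c^{(x)}_1} RLx$$ are invertible (for all $x\in\mathcal{C}$). In this case $L^{\mathrm{op}}$ is a quasi-inverse of $R$.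
   Context: Monoidal categories are taken to be strict. A monoidal category $\mathcal{C}$ is right tensor-representable if for every $x\in\mathcal{C}$ there is an object $Rx$ such that $Rx\otimes-$ is right adjoint to $x\otimes-$; it is left tensor-representable if for every $x$ there is an object $Lx$ such that $-\otimes Lx$ is right adjoint to $-\otimes x$; it is tensor-representable if it is both. A tensor-representable category is left and right closed, with $[x,y]_r\cong Rx\otimes y$ (the right adjoint of $x\otimes-$) and $[x,y]_\ell\cong y\otimes Lx$ (the right adjoint of $-\otimes x$). The right and left dualising functors are $R=[-,1]_r$ and $L=[-,1]_\ell$, both $\mathcal{C}^{\mathrm{op}}\to\mathcal{C}$. The units and counits of the adjunctions $x\otimes-\dashv Rx\otimes-$ and $-\otimes x\dashv-\otimes Lx$ are denoted $$\eta^{(x)}_y\colon y\to Rx\otimes x\otimes y,\quad \varepsilon^{(x)}_y\colon x\otimes Rx\otimes y\to y,\quad u^{(x)}_y\colon y\to y\otimes x\otimes Lx,\quad c^{(x)}_y\colon y\otimes Lx\otimes x\to y.$$ In formulas, an object stands for its identity morphism. *)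

(* Defs.v *)
From Corelib Require Import ssreflect.

Set Implicit Arguments.
Unset Strict Implicit.
Unset Printing Implicit Defensive.

Declare Scope cat_scope.
Delimit Scope cat_scope with cat.
Open Scope cat_scope.

Reserved Notation "g ∘ f" (at level 40, left associativity).
Reserved Notation "x ⊗ y" (at level 38, left associativity).
Reserved Notation "f ⊗₁ g" (at level 38, left associativity).

(** * Categories, functors, natural transformations *)

Record Category := {
  obj :> Type;
  hom : obj -> obj -> Type;
  idm : forall x, hom x x;
  comp : forall x y z, hom y z -> hom x y -> hom x z;
  comp_idl : forall x y (f : hom x y), comp (idm y) f = f;
  comp_idr : forall x y (f : hom x y), comp f (idm x) = f;
  comp_assoc : forall w x y z (h : hom y z) (g : hom x y) (f : hom w x),
    comp h (comp g f) = comp (comp h g) f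
}.

Arguments hom {C} x y : rename.
Arguments idm {C} x : rename.
Arguments comp {C x y z} g f : rename.
Notation "g ∘ f" := (comp g f) : cat_scope.

Definition is_iso (C : Category) (x y : C) (f : hom x y) : Prop :=
  exists g : hom y x, g ∘ f = idm x /\ f ∘ g = idm y.

(** The identity morphism, seen as a morphism between provably equal objects;
    it is used to state strictness equations and to compose across them. *)
Definition eqhom (C : Category) (x y : C) (e : x = y) : hom x y :=
  match e in _ = y return hom x y with eq_refl => idm x end.

Lemma eqhom_symK (C : Category) (x y : C) (e : x = y) :
  eqhom (eq_sym e) ∘ eqhom e = idm x.
Proof. by case: _ / e; rewrite comp_idl. Qed.

Lemma eqhomK_sym (C : Category) (x y : C) (e : x = y) :
  eqhom e ∘ eqhom (eq_sym e) = idm y.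
Proof. by case: _ / e; rewrite comp_idl. Qed.

Definition op (C : Category) : Category := {|
  obj := C;
  hom := fun x y => @hom C y x;
  idm := @idm C;
  comp := fun x y z g f => @comp C z y x f g;
  comp_idl := fun x y f => comp_idr f;
  comp_idr := fun x y f => comp_idl f;
  comp_assoc := fun w x y z h g f => eq_sym (comp_assoc f g h)
|}.

Record Functor (C D : Category) := {
  fobj :> C -> D;
  fmap : forall x y, hom x y -> hom (fobj x) (fobj y);
  fmap_id : forall x, fmap (idm x) = idm (fobj x);
  fmap_comp : forall x y z (g : hom y z) (f : hom x y),
    fmap (g ∘ f) = fmap g ∘ fmap f
}.

Arguments fmap {C D} F {x y} f : rename.

Definition idF (C : Category) : Functor C C := {|
  fobj := fun x => x;
  fmap := fun _ _ f => f;
  fmap_id := fun _ => eq_refl;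
  fmap_comp := fun _ _ _ _ _ => eq_refl
|}.

Program Definition compF (C D E : Category) (G : Functor D E) (F : Functor C D) :
  Functor C E := {|
  fobj := fun x => G (F x);
  fmap := fun _ _ f => fmap G (fmap F f)
|}.
Next Obligation. by move=> * /=; rewrite !fmap_id. Qed.
Next Obligation. by move=> * /=; rewrite !fmap_comp. Qed.

(** A functor [F : C^op -> D], regarded as [F^op : C -> D^op]. *)
Definition opF (C D : Category) (F : Functor (op C) D) : Functor C (op D) := {|
  fobj := (fun x => F x) : C -> op D;
  fmap := fun x y (f : @hom C x y) => @fmap (op C) D F y x f;
  fmap_id := fun x => @fmap_id (op C) D F x;
  fmap_comp := fun x y z g f => @fmap_comp (op C) D F z y x f g
|}.

(** [F] with its values on objects replaced by equal ones. *)
Program Definition transportF (C D : Category) (F : Functor C D) (o : C -> D)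
    (e : forall x, F x = o x) : Functor C D := {|
  fobj := o;
  fmap := fun x y f => eqhom (e y) ∘ fmap F f ∘ eqhom (eq_sym (e x))
|}.
Next Obligation. by move=> * /=; rewrite fmap_id comp_idr eqhomK_sym. Qed.
Next Obligation.
move=> C D F o e x y z g f /=; rewrite fmap_comp !comp_assoc.
rewrite -(comp_assoc _ (eqhom (eq_sym (e y)))) eqhom_symK comp_idr.
by rewrite -!comp_assoc.
Qed.

Record NatTrans (C D : Category) (F G : Functor C D) := {
  ntc :> forall x, hom (F x) (G x);
  nt_natural : forall x y (f : hom x y), fmap G f ∘ ntc x = ntc y ∘ fmap F f
}.

Definition naturally_isomorphic (C D : Category) (F G : Functor C D) : Prop :=
  exists a : NatTrans F G, forall x, is_iso (a x).

Definition quasi_inverse (C D : Category) (F : Functor C D) (G : Functor D C) :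
  Prop :=
  naturally_isomorphic (compF G F) (idF C) /\
  naturally_isomorphic (compF F G) (idF D).

Definition is_equivalence (C D : Category) (F : Functor C D) : Prop :=
  exists G : Functor D C, quasi_inverse F G.

(** [Adjunction F G]: an adjunction in which [F] is left adjoint to [G]. *)
Record Adjunction (C D : Category) (F : Functor C D) (G : Functor D C) := {
  adj_unit : NatTrans (idF C) (compF G F);
  adj_counit : NatTrans (compF F G) (idF D);
  adj_triangle_l : forall x : C,
    adj_counit (F x) ∘ fmap F (adj_unit x) = idm (F x);
  adj_triangle_r : forall y : D,
    fmap G (adj_counit y) ∘ adj_unit (G y) = idm (G y)
}.

(** For [F -| G] and [F' -| G'], the transformation [G' => G] conjugate to
    [a : F => F']. *)
Definition conj (C D : Category) (F F' : Functor C D) (G G' : Functor D C)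
    (A : Adjunction F G) (A' : Adjunction F' G') (a : NatTrans F F') (y : D) :
  hom (G' y) (G y) :=
  fmap G (adj_counit A' y ∘ a (G' y)) ∘ adj_unit A (G' y).

Lemma conj_id (C D : Category) (F : Functor C D) (G : Functor D C)
    (A : Adjunction F G) (a : NatTrans F F) (y : D) :
  (forall x, a x = idm (F x)) -> conj A A a y = idm (G y).
Proof. by move=> a1; rewrite /conj a1 comp_idr adj_triangle_r. Qed.

Lemma conj_comp (C D : Category) (F F' F'' : Functor C D) (G G' G'' : Functor D C)
    (A : Adjunction F G) (A' : Adjunction F' G') (A'' : Adjunction F'' G'')
    (a : NatTrans F F') (b : NatTrans F' F'') (ba : NatTrans F F'') (y : D) :
  (forall x, ba x = b x ∘ a x) ->
  conj A A'' ba y = conj A A' a y ∘ conj A' A'' b y.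
Proof.
move=> baE; rewrite /conj baE.
set h := adj_counit A'' y ∘ b (G'' y).
have hE : h = adj_counit A' y ∘ fmap F' (fmap G' h ∘ adj_unit A' (G'' y)).
  rewrite fmap_comp comp_assoc.
  have /= <- := nt_natural (adj_counit A') h.
  by rewrite -comp_assoc adj_triangle_l comp_idr.
have ba_k : fmap F' (fmap G' h ∘ adj_unit A' (G'' y)) ∘ a (G'' y) =
    a (G' y) ∘ fmap F (fmap G' h ∘ adj_unit A' (G'' y)) := nt_natural a _.
rewrite comp_assoc -/h [in LHS]hE -comp_assoc ba_k comp_assoc fmap_comp -!comp_assoc.
congr (_ ∘ _).
exact: (nt_natural (adj_unit A) (fmap G' h ∘ adj_unit A' (G'' y))).
Qed.

(** * Strict monoidal categories *)

(** Strict associativity and unitality hold on objects and on morphisms; on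
    morphisms the two sides are compared through [eqhom]. *)
Record StrictMonoidalCategory := {
  smc_cat :> Category;
  tens : smc_cat -> smc_cat -> smc_cat;
  tens1 : forall x x' y y' : smc_cat,
    hom x x' -> hom y y' -> hom (tens x y) (tens x' y');
  one : smc_cat;
  tens1_id : forall x y, tens1 (idm x) (idm y) = idm (tens x y);
  tens1_comp : forall (x x' x'' y y' y'' : smc_cat)
      (f' : hom x' x'') (f : hom x x') (g' : hom y' y'') (g : hom y y'),
    tens1 (f' ∘ f) (g' ∘ g) = tens1 f' g' ∘ tens1 f g;
  tensA : forall x y z, tens (tens x y) z = tens x (tens y z);
  one_tens : forall x, tens one x = x;
  tens_one : forall x, tens x one = x;
  tens1A : forall (x x' y y' z z' : smc_cat)
      (f : hom x x') (g : hom y y') (h : hom z z'),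
    eqhom (tensA x' y' z') ∘ tens1 (tens1 f g) h =
    tens1 f (tens1 g h) ∘ eqhom (tensA x y z);
  one_tens1 : forall (x x' : smc_cat) (f : hom x x'),
    eqhom (one_tens x') ∘ tens1 (idm one) f = f ∘ eqhom (one_tens x);
  tens1_one : forall (x x' : smc_cat) (f : hom x x'),
    eqhom (tens_one x') ∘ tens1 f (idm one) = f ∘ eqhom (tens_one x)
}.

Arguments tens {C} x y : rename.
Arguments tens1 {C x x' y y'} f g : rename.
Arguments one {C} : rename.
Notation "x ⊗ y" := (tens x y) : cat_scope.
Notation "f ⊗₁ g" := (tens1 f g) : cat_scope.

(** The functor [x ⊗ -]. *)
Program Definition ltens (C : StrictMonoidalCategory) (x : C) : Functor C C := {|
  fobj := fun y => x ⊗ y;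
  fmap := fun _ _ g => idm x ⊗₁ g
|}.
Next Obligation. by move=> * /=; rewrite tens1_id. Qed.
Next Obligation. by move=> * /=; rewrite -tens1_comp comp_idl. Qed.

(** The functor [- ⊗ x]. *)
Program Definition rtens (C : StrictMonoidalCategory) (x : C) : Functor C C := {|
  fobj := fun y => y ⊗ x;
  fmap := fun _ _ g => g ⊗₁ idm x
|}.
Next Obligation. by move=> * /=; rewrite tens1_id. Qed.
Next Obligation. by move=> * /=; rewrite -tens1_comp comp_idl. Qed.

Program Definition ltens_nat (C : StrictMonoidalCategory) (x x' : C)
    (f : hom x x') : NatTrans (ltens x) (ltens x') := {|
  ntc := fun y => f ⊗₁ idm y
|}.
Next Obligation. by move=> * /=; rewrite -!tens1_comp !comp_idl !comp_idr. Qed.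

Program Definition rtens_nat (C : StrictMonoidalCategory) (x x' : C)
    (f : hom x x') : NatTrans (rtens x) (rtens x') := {|
  ntc := fun y => idm y ⊗₁ f
|}.
Next Obligation. by move=> * /=; rewrite -!tens1_comp !comp_idl !comp_idr. Qed.

(** * Tensor-representability *)

(** A choice of representing objects together with the adjunctions. *)
Record RightTensorRepresentable (C : StrictMonoidalCategory) := {
  Robj : C -> C;
  Radj : forall x, Adjunction (ltens x) (ltens (Robj x))
}.

Record LeftTensorRepresentable (C : StrictMonoidalCategory) := {
  Lobj : C -> C;
  Ladj : forall x, Adjunction (rtens x) (rtens (Lobj x))
}.

Record TensorRepresentable (C : StrictMonoidalCategory) := {
  right_rep :> RightTensorRepresentable C;
  left_rep :> LeftTensorRepresentable C
}.

Section Dualising.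

Variables (C : StrictMonoidalCategory) (T : TensorRepresentable C).

Definition eta (x y : C) : hom y (Robj T x ⊗ (x ⊗ y)) := adj_unit (Radj T x) y.
Definition eps (x y : C) : hom (x ⊗ (Robj T x ⊗ y)) y := adj_counit (Radj T x) y.
Definition u (x y : C) : hom y (y ⊗ x ⊗ Lobj T x) := adj_unit (Ladj T x) y.
Definition c (x y : C) : hom (y ⊗ Lobj T x ⊗ x) y := adj_counit (Ladj T x) y.

(** The functor [[-, y]_r], where [[x, y]_r = Rx ⊗ y] is the value at [y] of the
    right adjoint of [x ⊗ -]. *)
Program Definition ihom_r (y : C) : Functor (op C) C := {|
  fobj := fun x => Robj T x ⊗ y;
  fmap := fun x x' (f : @hom C x' x) =>
    conj (Radj T x') (Radj T x) (ltens_nat f) y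
|}.
Next Obligation.
move=> y x; apply: (conj_id (Radj T x)) => z /=; exact: tens1_id.
Qed.
Next Obligation.
move=> y x x' x'' g f.
apply: (conj_comp (Radj T x'') (Radj T x') (Radj T x)) => z /=.
by rewrite -tens1_comp comp_idl.
Qed.

(** The functor [[-, y]_l], where [[x, y]_l = y ⊗ Lx] is the value at [y] of the
    right adjoint of [- ⊗ x]. *)
Program Definition ihom_l (y : C) : Functor (op C) C := {|
  fobj := fun x => y ⊗ Lobj T x;
  fmap := fun x x' (f : @hom C x' x) =>
    conj (Ladj T x') (Ladj T x) (rtens_nat f) y
|}.
Next Obligation.
move=> y x; apply: (conj_id (Ladj T x)) => z /=; exact: tens1_id.
Qed.
Next Obligation.
move=> y x x' x'' g f.
apply: (conj_comp (Ladj T x'') (Ladj T x') (Ladj T x)) => z /=.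
by rewrite -tens1_comp comp_idl.
Qed.

(** [R = [-, 1]_r] and [L = [-, 1]_l], using [Rx ⊗ 1 = Rx] and [1 ⊗ Lx = Lx]. *)
Definition R : Functor (op C) C :=
  @transportF (op C) C (ihom_r one) (Robj T) (fun x => tens_one (Robj T x)).
Definition L : Functor (op C) C :=
  @transportF (op C) C (ihom_l one) (Lobj T) (fun x => one_tens (Lobj T x)).

(** [eps x 1] and [c x 1], with the strict identifications on their sources. *)
Definition eps1 (x : C) : hom (x ⊗ R x) one :=
  eps x one ∘ eqhom (f_equal (fun z => x ⊗ z) (eq_sym (tens_one (R x)))).
Definition c1 (x : C) : hom (L x ⊗ x) one :=
  c x one ∘ eqhom (f_equal (fun z => z ⊗ x) (eq_sym (one_tens (L x)))).

(** [x -> x ⊗ Rx ⊗ LRx -> LRx] and [x -> RLx ⊗ Lx ⊗ x -> RLx]. *)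
Definition to_LR (x : C) : hom x (L (R x)) :=
  eqhom (one_tens (L (R x))) ∘ (eps1 x ⊗₁ idm (L (R x))) ∘ u (R x) x.
Definition to_RL (x : C) : hom x (R (L x)) :=
  eqhom (tens_one (R (L x))) ∘ (idm (R (L x)) ⊗₁ c1 x) ∘ eta (L x) x.

End Dualising.

(* Main.v *)
From Corelib Require Import ssreflect.
From Stdlib Require Import IndefiniteDescription.
Require Import Defs.

Set Implicit Arguments.
Unset Strict Implicit.
Unset Printing Implicit Defensive.

(** Both sides of the adjunction classify pairings with values in the unit
    object: since [x ⊗ -] is left adjoint to [Rx ⊗ -] and [- ⊗ x] to [- ⊗ Lx],
    there are bijections
<<
      hom y (L x)  ~  hom (y ⊗ x) 1  ~  hom x (R y),
>>
    given by [f |-> c1 x ∘ (f ⊗ x)] on the left and [g |-> eps1 y ∘ (y ⊗ g)] on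
    the right.  A morphism into a dual is thus determined by the pairing that it
    induces ([eps1_inj], [c1_inj]), and the constructions at hand are given by
    simple pairings: [R f] and [L f] make the evaluations dinatural ([eps1_R],
    [c1_L]), while [to_RL x] and [to_LR x] exchange the two evaluations: the
    first represents [c1 x] as a pairing of [L x] with [x], the second
    represents [eps1 x] as a pairing of [x] with [R x] ([eps1_to_RL],
    [c1_to_LR]).  Naturality of [to_RL] and [to_LR] and the triangle identities
    are then comparisons of pairings, so these two families are the unit and
    the counit of [L^op -| R].  The strictness isomorphisms are absorbed in
    these four formulas.

    The rest holds for any adjunction [F -| G]: if the unit and the counit are
    invertible, [F] and [G] are quasi-inverse; conversely, if [G] is an
    equivalence, the counit is invertible because [G] is fully faithful, and
    then the unit is invertible on the image of [G] by a triangle identity, and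
    everywhere because [G] is essentially surjective. *)

(** * Isomorphisms *)

Lemma is_iso_comp (C : Category) (x y z : C) (g : hom y z) (f : hom x y) :
  is_iso g -> is_iso f -> is_iso (g ∘ f).
Proof.
move=> [g' [g'g gg']] [f' [f'f ff']]; exists (f' ∘ g'); split.
  by rewrite comp_assoc -(comp_assoc f') g'g comp_idr.
by rewrite comp_assoc -(comp_assoc g) ff' comp_idr.
Qed.

Lemma is_iso_cancel_l (C : Category) (x y z : C) (g : hom y z) (f : hom x y) :
  is_iso g -> is_iso (g ∘ f) -> is_iso f.
Proof.
move=> [g' [g'g gg']] gf_iso.
have -> : f = g' ∘ (g ∘ f) by rewrite comp_assoc g'g comp_idl.
by apply: is_iso_comp => //; exists g.
Qed.

Lemma is_iso_cancel_r (C : Category) (x y z : C) (g : hom y z) (f : hom x y) :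
  is_iso f -> is_iso (g ∘ f) -> is_iso g.
Proof.
move=> [f' [f'f ff']] gf_iso.
have -> : g = g ∘ f ∘ f' by rewrite -comp_assoc ff' comp_idr.
by apply: is_iso_comp => //; exists f.
Qed.

Lemma is_iso_fmap (C D : Category) (F : Functor C D) (x y : C) (f : hom x y) :
  is_iso f -> is_iso (fmap F f).
Proof.
move=> [g [gf fg]]; exists (fmap F g).
by rewrite -!fmap_comp gf fg !fmap_id.
Qed.

Lemma is_iso_epi (C : Category) (x y z : C) (f : hom x y) (g h : hom y z) :
  is_iso f -> g ∘ f = h ∘ f -> g = h.
Proof.
move=> [f' [_ ff']] gf.
by rewrite -(comp_idr g) -(comp_idr h) -ff' !comp_assoc gf.
Qed.

Lemma is_iso_op (C : Category) (x y : C) (f : hom x y) :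
  is_iso f <-> @is_iso (op C) y x f.
Proof. by split=> -[g [gf fg]]; exists g. Qed.

(** Invertibility only asserts that an inverse exists in each component; the
    inverse transformation is assembled by choice. *)
Lemma naturally_isomorphic_sym (C D : Category) (F G : Functor C D) :
  naturally_isomorphic F G -> naturally_isomorphic G F.
Proof.
move=> [a a_iso].
pose inv x := constructive_indefinite_description _ (a_iso x).
pose b x : hom (G x) (F x) := proj1_sig (inv x).
have ba x : b x ∘ a x = idm (F x) by case: (proj2_sig (inv x)).
have ab x : a x ∘ b x = idm (G x) by case: (proj2_sig (inv x)).
have b_nat x y (f : hom x y) : fmap F f ∘ b x = b y ∘ fmap G f.
  rewrite -[LHS]comp_idl -(ba y) comp_assoc -(comp_assoc _ (a y)).
  by rewrite -nt_natural -!comp_assoc ab comp_idr.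
exists (@Build_NatTrans C D G F b b_nat) => x.
by exists (a x).
Qed.

(** * Equivalences *)

Lemma nat_iso_id_faithful (C D : Category) (F : Functor C D) (G : Functor D C)
    (x y : C) (f g : hom x y) :
  naturally_isomorphic (compF G F) (idF C) -> fmap F f = fmap F g -> f = g.
Proof.
move=> [a a_iso] Ffg; apply: (is_iso_epi (a_iso x)).
have /= -> := nt_natural a f; have /= -> := nt_natural a g.
by rewrite Ffg.
Qed.

Lemma is_equivalence_faithful (C D : Category) (F : Functor C D) (x y : C)
    (f g : hom x y) :
  is_equivalence F -> fmap F f = fmap F g -> f = g.
Proof. by move=> [G [GF _]]; apply: nat_iso_id_faithful GF. Qed.

(** A preimage of [g] is found by conjugating [G g] with [a : GF => id]; that
    it is mapped to [g] can be tested after applying [G], because [G] is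
    faithful as well. *)
Lemma is_equivalence_full (C D : Category) (F : Functor C D) (x y : C)
    (g : hom (F x) (F y)) :
  is_equivalence F -> exists f : hom x y, fmap F f = g.
Proof.
move=> [G [[a a_iso] FG]].
have [ax' [ax'a aax']] := a_iso x; have [ay' [ay'a aay']] := a_iso y.
pose f := a y ∘ fmap G g ∘ ax'; exists f.
apply: (nat_iso_id_faithful FG); apply: (is_iso_epi (f := ax')).
  by exists (a x).
have nat_a : f ∘ a x = a y ∘ fmap G (fmap F f) := nt_natural a f.
rewrite -[LHS]comp_idl -ay'a -comp_assoc (comp_assoc (a y)) -nat_a.
by rewrite -comp_assoc aax' comp_idr /f !comp_assoc ay'a comp_idl.
Qed.

Lemma is_equivalence_ess_surj (C D : Category) (F : Functor C D) (y : D) :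
  is_equivalence F -> exists (x : C) (f : hom (F x) y), is_iso f.
Proof. by move=> [G [_ [b b_iso]]]; exists (G y), (b y); exact: b_iso. Qed.

(** * Adjunctions *)

Section Adjunctions.

Variables (C D : Category) (F : Functor C D) (G : Functor D C).
Variable A : Adjunction F G.

Lemma adj_transposeK (x : C) (y : D) (h : hom (F x) y) :
  adj_counit A y ∘ fmap F (fmap G h ∘ adj_unit A x) = h.
Proof.
rewrite fmap_comp comp_assoc.
have /= <- := nt_natural (adj_counit A) h.
by rewrite -comp_assoc adj_triangle_l comp_idr.
Qed.

Lemma adj_untransposeK (x : C) (y : D) (f : hom x (G y)) :
  fmap G (adj_counit A y ∘ fmap F f) ∘ adj_unit A x = f.
Proof.
rewrite fmap_comp -comp_assoc.
have /= -> := nt_natural (adj_unit A) f.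
by rewrite comp_assoc adj_triangle_r comp_idl.
Qed.

Lemma adj_counit_inj (x : C) (y : D) (f g : hom x (G y)) :
  adj_counit A y ∘ fmap F f = adj_counit A y ∘ fmap F g -> f = g.
Proof. by move=> fg; rewrite -(adj_untransposeK f) fg adj_untransposeK. Qed.

Lemma adj_unit_inj (x : C) (y : D) (f g : hom (F x) y) :
  fmap G f ∘ adj_unit A x = fmap G g ∘ adj_unit A x -> f = g.
Proof. by move=> fg; rewrite -(adj_transposeK f) fg adj_transposeK. Qed.

(** Fullness yields [h] with [G h = adj_unit A (G y)].  It is a right inverse of
    the counit by a triangle identity and faithfulness, and a left inverse
    because [h ∘ adj_counit A y] and the identity have the same transpose. *)
Lemma adj_counit_iso (y : D) : is_equivalence G -> is_iso (adj_counit A y).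
Proof.
move=> G_eq.
have [h Gh] := is_equivalence_full (adj_unit A (G y) : hom (G y) (G (F (G y)))) G_eq.
exists h; split.
  apply: adj_unit_inj; rewrite fmap_comp -comp_assoc adj_triangle_r Gh fmap_id.
  by rewrite comp_idl comp_idr.
apply: (is_equivalence_faithful G_eq).
by rewrite fmap_comp Gh adj_triangle_r fmap_id.
Qed.

Lemma adj_unit_iso (x : C) : is_equivalence G -> is_iso (adj_unit A x).
Proof.
move=> G_eq.
have [y [f f_iso]] := is_equivalence_ess_surj x G_eq.
apply: (is_iso_cancel_r f_iso).
have /= <- := nt_natural (adj_unit A) f.
apply: is_iso_comp; first exact/is_iso_fmap/is_iso_fmap.
apply: (is_iso_cancel_l (is_iso_fmap G (adj_counit_iso y G_eq))).
by rewrite adj_triangle_r; exists (idm (G y)); rewrite comp_idl.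
Qed.

Lemma adj_quasi_inverse :
  (forall x, is_iso (adj_unit A x)) -> (forall y, is_iso (adj_counit A y)) ->
  quasi_inverse G F.
Proof.
move=> unit_iso counit_iso; split; first by exists (adj_counit A).
by apply: naturally_isomorphic_sym; exists (adj_unit A).
Qed.

End Adjunctions.

(** The defining property of the conjugate transformation: it is compatible
    with the counits. *)
Lemma adj_counit_conj (C D : Category) (F F' : Functor C D) (G G' : Functor D C)
    (A : Adjunction F G) (A' : Adjunction F' G') (a : NatTrans F F') (y : D) :
  adj_counit A y ∘ fmap F (conj A A' a y) = adj_counit A' y ∘ a (G' y).
Proof. exact: adj_transposeK. Qed.

(** * Evaluation pairings and duals *)

Section Dualising.

Variables (C : StrictMonoidalCategory) (T : TensorRepresentable C).

Lemma eqhom_ltens (x y z : C) (e : y = z) :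
  eqhom (f_equal (fun z => x ⊗ z) e) = idm x ⊗₁ eqhom e.
Proof. by case: _ / e; rewrite /= tens1_id. Qed.

Lemma eqhom_rtens (x y z : C) (e : y = z) :
  eqhom (f_equal (fun z => z ⊗ x) e) = eqhom e ⊗₁ idm x.
Proof. by case: _ / e; rewrite /= tens1_id. Qed.

Lemma eqhom_sym_inj (x y z : C) (e : y = z) (f g : hom x z) :
  eqhom (eq_sym e) ∘ f = eqhom (eq_sym e) ∘ g -> f = g.
Proof. by case: _ / e f g => f g /=; rewrite !comp_idl. Qed.

Lemma tens1_swap (x x' y y' : C) (f : hom x x') (g : hom y y') :
  (f ⊗₁ idm y') ∘ (idm x ⊗₁ g) = (idm x' ⊗₁ g) ∘ (f ⊗₁ idm y).
Proof. by rewrite -!tens1_comp !comp_idl !comp_idr. Qed.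

(** The pairing of [g : z -> R x] is the transpose of [g] for the adjunction
    [x ⊗ - -| Rx ⊗ -], up to strictness. *)
Lemma eps1E (x z : C) (g : hom z (R T x)) :
  eps1 T x ∘ (idm x ⊗₁ g) =
  eps T x one ∘ (idm x ⊗₁ (eqhom (eq_sym (tens_one (R T x))) ∘ g)).
Proof.
by rewrite /eps1 eqhom_ltens -comp_assoc -tens1_comp comp_idl.
Qed.

Lemma c1E (x z : C) (g : hom z (L T x)) :
  c1 T x ∘ (g ⊗₁ idm x) =
  c T x one ∘ ((eqhom (eq_sym (one_tens (L T x))) ∘ g) ⊗₁ idm x).
Proof.
by rewrite /c1 eqhom_rtens -comp_assoc -tens1_comp comp_idl.
Qed.

Lemma eps1_inj (x z : C) (f g : hom z (R T x)) :
  eps1 T x ∘ (idm x ⊗₁ f) = eps1 T x ∘ (idm x ⊗₁ g) -> f = g.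
Proof.
rewrite !eps1E => /(adj_counit_inj (A := Radj T x)).
exact: eqhom_sym_inj.
Qed.

Lemma c1_inj (x z : C) (f g : hom z (L T x)) :
  c1 T x ∘ (f ⊗₁ idm x) = c1 T x ∘ (g ⊗₁ idm x) -> f = g.
Proof.
rewrite !c1E => /(adj_counit_inj (A := Ladj T x)).
exact: eqhom_sym_inj.
Qed.

(** [fmap (R T) f] is by definition the conjugate of [f ⊗ -], and conjugates are
    compatible with the counits. *)
Lemma eps1_R (x x' : C) (f : hom x x') :
  eps1 T x ∘ (idm x ⊗₁ @fmap (op C) C (R T) x' x f) =
  eps1 T x' ∘ (f ⊗₁ idm (R T x')).
Proof.
rewrite eps1E /= !comp_assoc eqhom_symK comp_idl.
rewrite -{1}(comp_idl (idm x)) tens1_comp comp_assoc.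
have /= -> := adj_counit_conj (Radj T x) (Radj T x') (ltens_nat f) one.
by rewrite /eps1 eqhom_ltens -!comp_assoc tens1_swap.
Qed.

Lemma c1_L (x x' : C) (f : hom x x') :
  c1 T x ∘ (@fmap (op C) C (L T) x' x f ⊗₁ idm x) =
  c1 T x' ∘ (idm (L T x') ⊗₁ f).
Proof.
rewrite c1E /= !comp_assoc eqhom_symK comp_idl.
rewrite -{1}(comp_idl (idm x)) tens1_comp comp_assoc.
have /= -> := adj_counit_conj (Ladj T x) (Ladj T x') (rtens_nat f) one.
by rewrite /c1 eqhom_rtens -!comp_assoc -tens1_swap.
Qed.

Lemma eps1_to_RL (x : C) :
  eps1 T (L T x) ∘ (idm (L T x) ⊗₁ to_RL T x) = c1 T x.
Proof.
rewrite eps1E /to_RL !comp_assoc eqhom_symK comp_idl.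
exact: (adj_transposeK (Radj T (L T x)) (c1 T x)).
Qed.

Lemma c1_to_LR (x : C) :
  c1 T (R T x) ∘ (to_LR T x ⊗₁ idm (R T x)) = eps1 T x.
Proof.
rewrite c1E /to_LR !comp_assoc eqhom_symK comp_idl.
exact: (adj_transposeK (Ladj T (R T x)) (eps1 T x)).
Qed.

(** * The adjunction between the dualising functors *)

(** Both sides induce the pairing [c1 T x' ∘ (idm (L T x') ⊗₁ f)] of [L T x']
    with [x]. *)
Lemma to_RL_natural (x x' : C) (f : hom x x') :
  fmap (compF (R T) (opF (L T))) f ∘ to_RL T x = to_RL T x' ∘ f.
Proof.
apply: eps1_inj.
rewrite -[in LHS](comp_idl (idm (L T x'))) -[in RHS](comp_idl (idm (L T x'))).
rewrite !tens1_comp !comp_assoc eps1_to_RL [X in X ∘ _ = _]eps1_R.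
by rewrite -comp_assoc tens1_swap comp_assoc eps1_to_RL [LHS]c1_L.
Qed.

(** Both sides induce the pairing [eps1 T x' ∘ (f ⊗₁ idm (R T x'))] of [x] with
    [R T x']. *)
Lemma to_LR_natural (x x' : C) (f : hom x x') :
  @fmap (op C) C (L T) (R T x) (R T x') (@fmap (op C) C (R T) x' x f)
    ∘ to_LR T x =
  to_LR T x' ∘ f.
Proof.
apply: c1_inj.
rewrite -[in LHS](comp_idl (idm (R T x'))) -[in RHS](comp_idl (idm (R T x'))).
rewrite !tens1_comp !comp_assoc c1_to_LR [X in X ∘ _ = _]c1_L.
by rewrite -comp_assoc -tens1_swap comp_assoc c1_to_LR [LHS]eps1_R.
Qed.

Lemma L_to_RL_triangle (x : C) :
  @fmap (op C) C (L T) (R T (L T x)) x (to_RL T x) ∘ to_LR T (L T x) =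
  idm (L T x).
Proof.
apply: c1_inj.
rewrite -{1}(comp_idl (idm x)) tens1_comp comp_assoc c1_L.
by rewrite -comp_assoc -tens1_swap comp_assoc c1_to_LR eps1_to_RL tens1_id comp_idr.
Qed.

Lemma R_to_LR_triangle (x : C) :
  @fmap (op C) C (R T) (L T (R T x)) x (to_LR T x) ∘ to_RL T (R T x) =
  idm (R T x).
Proof.
apply: eps1_inj.
rewrite -{1}(comp_idl (idm x)) tens1_comp comp_assoc eps1_R.
by rewrite -comp_assoc tens1_swap comp_assoc eps1_to_RL c1_to_LR tens1_id comp_idr.
Qed.

Definition to_RL_nat : NatTrans (idF C) (compF (R T) (opF (L T))) :=
  @Build_NatTrans C C (idF C) (compF (R T) (opF (L T))) (to_RL T) to_RL_natural.

Definition to_LR_nat : NatTrans (compF (opF (L T)) (R T)) (idF (op C)) :=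
  @Build_NatTrans (op C) (op C) (compF (opF (L T)) (R T)) (idF (op C))
    (to_LR T) (fun x' x f => eq_sym (@to_LR_natural x x' f)).

Definition dualising_adjunction : Adjunction (opF (L T)) (R T) :=
  @Build_Adjunction C (op C) (opF (L T)) (R T) to_RL_nat to_LR_nat
    L_to_RL_triangle R_to_LR_triangle.

End Dualising.

Theorem proposition3p6 (C : StrictMonoidalCategory) (T : TensorRepresentable C) :
  inhabited (Adjunction (opF (L T)) (R T)) /\
  (is_equivalence (R T) <->
    (forall x : C, is_iso (to_LR T x) /\ is_iso (to_RL T x))) /\
  (is_equivalence (R T) -> quasi_inverse (R T) (opF (L T))).
Proof.
pose A := dualising_adjunction T.
have isoP : is_equivalence (R T) ->
    forall x : C, is_iso (to_LR T x) /\ is_iso (to_RL T x).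
  move=> R_eq x; split; last exact: (adj_unit_iso A x R_eq).
  exact/is_iso_op/(adj_counit_iso A x R_eq).
have quasiP : (forall x : C, is_iso (to_LR T x) /\ is_iso (to_RL T x)) ->
    quasi_inverse (R T) (opF (L T)).
  move=> iso; apply: (adj_quasi_inverse (A := A)) => x; first by case: (iso x).
  by apply/is_iso_op; case: (iso x).
split; first by exists.
split; last by move=> /isoP /quasiP.
by split=> [/isoP // | /quasiP LR]; exists (opF (L T)).
Qed.
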